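(* Let $P=(Z,<)$ be a causal set, and suppose there is some $k$ such that $|I(x)|\le k$ for all $x\in Z$, where $I(x)$ is the set of elements of $Z$ incomparable with $x$. Then there is a unique order-invariant measure on $P$.
   Context: A causal set is a partially ordered set $P=(Z,<)$ with $Z$ countably infinite such that $\{y: y<z\}$ is finite for every $z\in Z$. A down-set is a subset closed downwards; a stem is a finite down-set. For $W\subseteq Z$, $P\setminus W$ is the restriction of $P$ to $Z\setminus W$. An ordered stem is a finite string $a_1\cdots a_k$ of distinct elements such that $\{a_1,\dots,a_k\}$ is a down-set and $a_i<a_j$ implies $i<j$. $\Omega^P$ is the set of infinite strings $\omega=x_1x_2\cdots$ of elements of $Z$ such that each $x_k$ is a minimal element of $P\setminus\{x_1,\dots,x_{k-1}\}$. The basic event $E(a_1\cdots a_k)$ is the set of $\omega\in\Omega^P$ beginning with $a_1\cdots a_k$, and $\mathcal{F}^P$ is the $\sigma$-field generated by basic events. An order-invariant measure on $P$ is a probability measure $\mu$ on $(\Omega^P,\mathcal{F}^P)$ such that whenever $a_1\cdots a_k$ and $a_{s(1)}\cdots a_{s(k)}$ are both ordered stems ($s$ a permutation of $\{1,\dots,k\}$), $\mu(E(a_1\cdots a_k))=\mu(E(a_{s(1)}\cdots a_{s(k)}))$. *)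

(* Defs.v *)
From HB Require Import structures.
From mathcomp Require Import all_boot all_order perm all_algebra.
From mathcomp Require Import all_classical all_reals all_analysis.

Set Implicit Arguments.
Unset Strict Implicit.
Unset Printing Implicit Defensive.

Import Order.TTheory.
Local Open Scope order_scope.
Local Open Scope classical_set_scope.

HB.mixin Record isCausal d Z of Order.POrder d Z := {
  causal_countable : countable [set: Z];
  causal_infinite : infinite_set [set: Z];
  causal_past_finite : forall z : Z, finite_set [set y : Z | y < z]
}.

#[short(type="causalSetType")]
HB.structure Definition CausalSet d :=
  {Z of isCausal d Z & Order.POrder d Z}.

Definition down_set {d} {Z : porderType d} (A : set Z) : Prop :=
  forall x y, A y -> x <= y -> A x.

Definition minimal_in {d} {Z : porderType d} (A : set Z) (x : Z) : Prop :=
  A x /\ forall y, A y -> ~~ (y < x).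

(* [><] is incomparability, so [x] itself is not in [incomparables x]. *)
Definition incomparables {d} {Z : porderType d} (x : Z) : set Z :=
  [set y | x >< y].

Definition ordered_stem {d} {Z : porderType d} k (a : k.-tuple Z) : Prop :=
  [/\ uniq a, down_set [set` a] &
      forall i j : 'I_k, tnth a i < tnth a j -> (i < j)%N].

(* Strings are indexed from 0, so [x @` `I_k] is the set of the first [k]
   letters. A string need not exhaust [Z]. *)
Definition Omega {d} (Z : porderType d) : set (nat -> Z) :=
  [set x | forall k, minimal_in (~` (x @` `I_k)) (x k)].
Arguments Omega {d} Z _.

(* [measurableType]s are pointed, hence the need to know that [Omega Z] is
   nonempty. *)
Lemma minimal_in_exists d (Z : causalSetType d) (A : set Z) :
  A !=set0 -> exists x, minimal_in A x.
Proof.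
move=> [z Az]; have /finite_seqP[s sE] := causal_past_finite z.
have : forall y, y < z -> y \in s.
  by move=> y yz; have : [set` s] y by rewrite -sE.
have [n] := ubnP (size s); elim: n s z Az {sE} => // n IHn s z Az sn sz.
have [[y [Ay yz]]|noy] := pselect (exists y, A y /\ y < z); last first.
  by exists z; split=> // y Ay; apply/negP => yz; apply: noy; exists y.
apply: (IHn (rem y s) y Ay) => [|u uy].
  rewrite size_rem ?sz// -ltnS (leq_trans _ sn)// ltnS.
  by case: (s) (sz _ yz).
apply: contraTT (sz _ (lt_trans uy yz)) => un; apply/negP => us.
have := perm_mem (perm_to_rem (sz _ yz)) u.
by rewrite us inE (negPf un) orbF => /esym/eqP uE; rewrite uE ltxx in uy.
Qed.

Lemma Omega_nonempty d (Z : causalSetType d) : Omega Z !=set0.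
Proof.
have /choice[f fP] : forall s : seq Z, exists x, minimal_in (~` [set` s]) x.
  move=> s; apply: minimal_in_exists; apply/set0P/negP => /eqP s0.
  apply: (@causal_infinite d Z); rewrite -setC0 -s0 setCK.
  exact: finite_seq.
pose pre n := iter n (fun s => f s :: s) [::].
exists (fun n => f (pre n)) => k.
suff -> : [set f (pre n) | n in `I_k] = [set` pre k] by exact: fP.
elim: k => [|k IHk]; first by rewrite II0 image_set0 set_nil.
rewrite IIS image_setU IHk image_set1; apply/seteqP; split=> y /=.
  by case=> [yk|->]; rewrite inE ?eqxx// yk orbT.
by rewrite inE => /orP[/eqP->|yk]; [right|left].
Qed.

Definition OmegaT {d} (Z : causalSetType d) : Type := Omega Z.
HB.instance Definition _ d (Z : causalSetType d) := Choice.on (OmegaT Z).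
HB.instance Definition _ d (Z : causalSetType d) :=
  isPointed.Build (OmegaT Z)
    (exist (fun x => x \in Omega Z) _ (mem_set (svalP (cid (Omega_nonempty Z))))).

Definition basic_event {d} {Z : causalSetType d} (a : seq Z) : set (OmegaT Z) :=
  [set w | mkseq (\val w) (size a) = a].

Definition Fsigma {d} (Z : causalSetType d) :=
  g_sigma_algebraType (range (@basic_event d Z)).

Definition order_invariant {R : realType} {d} {Z : causalSetType d}
    (mu : probability (Fsigma Z) R) : Prop :=
  forall k (a : k.-tuple Z) (s : 'S_k),
    ordered_stem a -> ordered_stem [tuple tnth a (s i) | i < k] ->
    mu (basic_event a) = mu (basic_event [tuple tnth a (s i) | i < k]).

(* Main.v *)
(* An order-invariant measure gives all orderings of a stem [A] the same basic
   event probability [h A], and [h] is harmonic: it is the sum of the values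
   [h (A + x)] over the minimal elements [x] of the complement of [A]. Every
   normalised nonnegative harmonic function arises in this way, so the claim is
   that there is exactly one.
   Uniqueness: a stem of size [n + k] contains every stem of size [n], since its
   elements not above a missing element [c] are below or incomparable to [c].
   Hence, as each stem has at most [k + 1] one-point extensions, [h] varies by a
   factor of at most [K = (k + 1)^k] over the stems of size [n], and two harmonic
   functions satisfy [g <= K^2 f]. Applying this to [f - c g] and iterating drives
   the constant to 1. Existence: take a limit, along an ultrafilter, of the
   uniform measures on the orderings of length [n]. The measure itself is the image
   of Lebesgue measure on [0, 1[, which is split successively into intervals of
   lengths given by the harmonic function. *)
Require Import Defs.
From HB Require Import structures.
From mathcomp Require Import all_boot all_order all_algebra finmap perm.
From mathcomp Require Import all_classical all_reals all_analysis.
From mathcomp Require Import lra ring.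
Local Open Scope classical_set_scope.
Local Open Scope card_scope.

Set Implicit Arguments.
Unset Strict Implicit.
Unset Printing Implicit Defensive.

Import Order.TTheory GRing.Theory Num.Theory.
Import numFieldNormedType.Exports.

(** * Sums over lists, limits along ultrafilters, consecutive blocks *)

Lemma ler_sum_subset (R : numDomainType) (I : eqType) (s1 s2 : seq I)
    (h : I -> R) : uniq s1 -> {subset s1 <= s2} ->
  (forall i, i \in s2 -> 0 <= h i)%R ->
  (\sum_(i <- s1) h i <= \sum_(i <- s2) h i)%R.
Proof.
elim: s1 s2 => [|i s1 IHs] s2 /=.
  by move=> _ _ h0; rewrite big_nil big_seq sumr_ge0.
move=> /andP[is1 us1] s12 h0; have is2 : i \in s2 by rewrite s12 ?mem_head.
rewrite big_cons (big_rem i is2)/= lerD2l; apply: IHs => // j.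
  move=> js1; have := s12 j; rewrite inE js1 orbT => /(_ isT).
  rewrite (perm_mem (perm_to_rem is2)) inE => /orP[/eqP ji|//].
  by rewrite ji (negPf is1) in js1.
by move=> /mem_rem; exact: h0.
Qed.

(** A cluster point of an ultrafilter is a limit: if a neighbourhood of it were not in the image
    filter, the complement would be, and would have to meet that neighbourhood. *)
Lemma ultra_compact_cvg T (V : topologicalType) (U : set_system T)
    (u : T -> V) (C : set V) : UltraFilter U -> compact C ->
  U (u @^-1` C) -> exists2 p, C p & u @ U --> p.
Proof.
move=> UU Cco UC; have [p [Cp clp]] := Cco (u @ U) _ UC.
exists p => // W Wp; have [//|NW] := in_ultra_setVsetC (u @^-1` W) UU.
by have [y [/= NWy /NWy]] := clp (~` W) W NW Wp.
Qed.

(* [offset g r x] is the left end of the block of length [g x] when blocks of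
   lengths [g] are laid end to end in the order of [r]. *)
Definition offset (R : nmodType) (I : eqType) (g : I -> R) (r : seq I) (x : I) :=
  (\sum_(y <- take (index x r) r) g y)%R.

Section Offset.
Context {R : realDomainType} {I : eqType} (g : I -> R) (r : seq I).
Hypothesis g_ge0 : forall x, x \in r -> (0 <= g x)%R.
Local Open Scope ring_scope.

Lemma offset_ge0 x : 0 <= offset g r x.
Proof. by rewrite /offset big_seq sumr_ge0// => y /mem_take/g_ge0. Qed.

Lemma offset_index x y : x \in r -> (index x r < index y r)%N ->
  offset g r x + g x <= offset g r y.
Proof.
move=> xr xy; have yr : (index y r <= size r)%N by exact: index_size.
rewrite /offset -(cat_take_drop (index x r).+1 (take (index y r) r)) take_takel//.
rewrite big_cat/= (take_nth x) ?index_mem// big_rcons/= nth_index// lerDl.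
by rewrite big_seq sumr_ge0// => z /mem_drop/mem_take/g_ge0.
Qed.

Lemma offset_sum x : x \in r -> offset g r x + g x <= \sum_(y <- r) g y.
Proof.
move=> xr; rewrite /offset -[in leRHS](cat_take_drop (index x r).+1 r) big_cat/=.
rewrite (take_nth x) ?index_mem// big_rcons/= nth_index// lerDl.
by rewrite big_seq sumr_ge0// => z /mem_drop/g_ge0.
Qed.

End Offset.

Lemma offset_inv (R : realDomainType) (I : eqType) (g : I -> R) (r : seq I) t :
  uniq r -> (0 <= t < \sum_(x <- r) g x)%R ->
  exists2 x, x \in r & (offset g r x <= t < offset g r x + g x)%R.
Proof.
rewrite /offset; elim: r t => [|y r IHr] t /=.
  by rewrite big_nil => _ /andP[/le_lt_trans/[apply]]; rewrite ltxx.
move=> /andP[yr ur]; rewrite big_cons => /andP[t0 tS].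
have [tg|gt] := ltrP t (g y).
  by exists y; rewrite ?mem_head// eqxx take0 big_nil t0 add0r.
have [|x xr xt] := IHr (t - g y)%R ur; first by rewrite subr_ge0 gt ltrBlDl.
exists x; first by rewrite inE xr orbT.
have yx : y != x by apply: contraNneq yr => ->.
by rewrite (negPf yx)/= big_cons -lerBrDl -addrA -ltrBlDl.
Qed.

(** * Stems and their one-point extensions *)

Section Stems.
Context {d : Order.disp_t} {Z : causalSetType d}.
Implicit Types (A B C : {fset Z}) (x y : Z).

Definition stem A : Prop := down_set [set` A].

(* Junk when [A] has infinitely many minimal non-elements: then [front A] is
   empty. *)
Definition front A : seq Z := fset_set (minimal_in (~` [set` A])).

(** [undup] because one stem is reached by several orders of adding its elements. By contrast
    [npaths] counts the orders themselves. *)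
Fixpoint up j A : seq {fset Z} :=
  if j is i.+1 then undup (flatten [seq up i (x |` A)%fset | x <- front A])
  else [:: A].

Fixpoint npaths j A : nat :=
  if j is i.+1 then \sum_(x <- front A) npaths i (x |` A)%fset else 1%N.

Lemma stem0 : stem fset0.
Proof. by move=> x y /=; rewrite inE. Qed.

Lemma stem_fsetU1 A x : stem A -> minimal_in (~` [set` A]) x ->
  stem (x |` A)%fset.
Proof.
move=> sA [/= /negP xA minx] y z /=; rewrite !inE => /orP[/eqP->|zA] yz.
  move: yz; rewrite le_eqVlt => /orP[->//|yx]; apply/orP; right.
  by apply: contraPT yx => /negP /minx/negP.
by apply/orP; right; exact: sA yz.
Qed.

(** A minimal element of [B] outside [A] is minimal in the whole complement of [A], since everything
    below it lies in [B]. *)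
Lemma minimal_in_setD A B : stem B -> (A `<` B)%fset ->
  exists2 x, x \in B & minimal_in (~` [set` A]) x.
Proof.
rewrite fproperE => sB /andP[_ /fsubsetPn[z zB zA]].
have [|x [[/= xB xA] minx]] := @minimal_in_exists _ Z ([set` B] `\` [set` A]).
  by exists z; split => //=; exact/negP.
exists x => //; split => // y yA; apply/negP => yx.
by have /negP := minx y (conj (sB _ _ xB (ltW yx)) yA).
Qed.

(** * Consequences of the bound on incomparable elements *)

Variable k : nat.
Hypothesis incomparables_le : forall x : Z, incomparables x #<= `I_k.

Let incomp_fset x := fset_set (incomparables x).

Let mem_incomp_fset x y : (y \in incomp_fset x) = (x >< y)%O.
Proof.
rewrite in_fset_set ?inE ?mem_setE//; last by apply/finite_set_leP; exists k.
Qed.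

(** Minimal elements of one set are pairwise incomparable, so any one of them and the elements
    incomparable to it account for all. *)
Lemma front_finite A : finite_set (minimal_in (~` [set` A])).
Proof.
have [[x [xA minx]]|no] := pselect (exists x, minimal_in (~` [set` A]) x);
  last by rewrite (_ : minimal_in _ = set0)// -subset0 => x mx; apply: no; exists x.
apply: (@sub_finite_set _ _ [set` (x |` incomp_fset x)%fset]) => // y [yA miny].
rewrite /= !inE mem_incomp_fset; have [//|yx/=] := eqVneq y x.
by apply/negP; rewrite /Order.comparable !le_eqVlt eq_sym (negPf yx)/=
  (negPf (minx _ yA)) (negPf (miny _ xA)).
Qed.

Lemma mem_front A x : (x \in front A) <-> minimal_in (~` [set` A]) x.
Proof. by rewrite /front in_fset_set ?inE//; exact: front_finite. Qed.

Lemma front_uniq A : uniq (front A).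
Proof. exact: fset_uniq. Qed.

Lemma front_notin A x : x \in front A -> x \notin A.
Proof. by move=> /mem_front[/negP]. Qed.

Lemma stem_front A x : stem A -> x \in front A -> stem (x |` A)%fset.
Proof. by move=> sA /mem_front; exact: stem_fsetU1. Qed.

Lemma cardfs_front A x : x \in front A -> #|` x |` A|%fset = #|` A|.+1.
Proof. by move=> /front_notin xA; rewrite cardfsU1 xA. Qed.

Lemma size_front A : (size (front A) <= k.+1)%N.
Proof.
case E : (front A) => [//|x s]; rewrite -E.
have /mem_front[xA minx] : x \in front A by rewrite E mem_head.
have : (size (front A) <= #|` (x |` incomp_fset x)%fset|)%N.
  apply: fsubset_leq_card; apply/fsubsetP => y yF.
  have /mem_front[yA miny] : y \in front A by [].
  rewrite !inE mem_incomp_fset; have [//|yx/=] := eqVneq y x.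
  by apply/negP; rewrite /Order.comparable !le_eqVlt eq_sym (negPf yx)/=
    (negPf (minx _ yA)) (negPf (miny _ xA)).
move=> /leq_trans; apply; rewrite cardfsU1 -addn1 addnC leq_add ?leq_b1//.
exact: geq_card_fset_set.
Qed.

Lemma front_neq0 A : exists x, x \in front A.
Proof.
have [|x mx] := @minimal_in_exists _ Z (~` [set` A]); last first.
  by exists x; exact/mem_front.
apply/set0P/negP => /eqP A0; apply: (@causal_infinite d Z).
by rewrite -setC0 -A0 setCK.
Qed.

Lemma mem_up j A B : stem A ->
  B \in up j A <-> [/\ stem B, (A `<=` B)%fset & #|` B| = (#|` A| + j)%N].
Proof.
elim: j A => [|j IHj] A sA /=.
  rewrite inE addn0; split=> [/eqP->//|[_ AB cB]].
  by rewrite eq_sym eqEfcard AB cB leqnn.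
rewrite mem_undup; split=> [/flatten_mapP[x xA]|[sB AB cB]].
  move=> /IHj[|sB xAB ->]; first exact: stem_front.
  rewrite cardfs_front// addnS; split=> //.
  exact: fsubset_trans (fsubsetUr _ _) xAB.
have [|x xB /mem_front xA] := @minimal_in_setD A B sB.
  by rewrite fproperEcard AB cB -addSnnS leq_addr.
apply/flatten_mapP; exists x => //; apply/IHj; first exact: stem_front.
by rewrite cardfs_front// fsubUset AB fsub1set xB cB addSnnS.
Qed.

Lemma up_uniq j A : uniq (up j A).
Proof. by case: j => //= j; exact: undup_uniq. Qed.

(* If [c] were missing from [B], all of [B] would lie below or beside [c], and
   what lies below [c] is in [C]. *)
Lemma stem_subset B C : stem B -> stem C -> (#|` C| + k <= #|` B|)%N ->
  (C `<=` B)%fset.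
Proof.
move=> sB sC cBC; apply/fsubsetP => c cC; apply/negPn/negP => cB.
have BC : (B `<=` (C `\ c) `|` incomp_fset c)%fset.
  apply/fsubsetP => b bB; rewrite !inE mem_incomp_fset.
  have bc : b != c by apply: contraNneq cB => <-.
  have Ncb : ~~ (c <= b)%O by apply: contraNN cB => cb; exact: sB cb.
  rewrite bc/= /Order.comparable (negPf Ncb)/=.
  by case: (boolP (b <= c)%O) => [/(sC _ _ cC)->|_]; rewrite ?orbT.
have := fsubset_leq_card BC; rewrite leqNgt => /negP; apply.
rewrite (leq_ltn_trans (leq_card_fsetU _ _))// (leq_trans _ cBC)//.
rewrite (cardfsD1 c C) cC add1n addSn ltnS leq_add2l.
exact: geq_card_fset_set.
Qed.

(** By [stem_subset], either list consists of all stems with [k] more elements than [C], so it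
    depends on [C] only through its size. *)
Lemma perm_up C C' : stem C -> stem C' -> #|` C| = #|` C'| ->
  perm_eq (up k C) (up k C').
Proof.
move=> sC sC' CC'; apply: uniq_perm; rewrite ?up_uniq// => B.
by apply/idP/idP => /mem_up[]// sB _ cB; apply/mem_up => //; split=> //;
  rewrite ?cB ?CC'//; apply: stem_subset; rewrite ?cB ?CC'.
Qed.

Lemma npaths_gt0 j A : (0 < npaths j A)%N.
Proof.
elim: j A => // j IHj A /=; have [x xA] := front_neq0 A.
by rewrite (big_rem x)//= addn_gt0 IHj.
Qed.

Lemma npaths_front j A x : x \in front A ->
  (npaths j (x |` A)%fset <= npaths j.+1 A)%N.
Proof. by move=> xA /=; rewrite (big_rem x)//= leq_addr. Qed.

(** While an intermediate stem [B] is smaller than [A], [minimal_in_setD] yields an element of [A]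
    in the front of [B]; the induction is on the number of missing elements. *)
Lemma stem_ind (P : {fset Z} -> Prop) : P fset0 ->
  (forall A x, stem A -> x \in front A -> P A -> P (x |` A)%fset) ->
  forall A, stem A -> P A.
Proof.
move=> P0 PU A sA; suff H j B : (stem B) -> (B `<=` A)%fset ->
    (#|` B| + j = #|` A|)%N -> P B -> P A.
  exact: (H _ fset0 stem0 (fsub0set _) (add0n _)).
elim: j B => [|j IHj] B sB BA cB PB.
  suff <- : B = A by [].
  by apply/eqP; rewrite eqEfcard BA -cB addn0 leqnn.
have [|x xA /mem_front xB] := @minimal_in_setD B A sA.
  by rewrite fproperEcard BA -cB -addSnnS leq_addr.
apply: (IHj (x |` B)%fset); [exact: stem_front| |by rewrite cardfs_front// addSnnS|].
  by rewrite fsubUset BA fsub1set xA.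
exact: PU.
Qed.

(** Every extension of [A] can be preceded by a fixed ordering of [A]. This bounds by 1 the ratios
    in [harmonic_exists]. *)
Lemma npaths_le j A : stem A -> (npaths j A <= npaths (#|` A| + j) fset0)%N.
Proof.
move=> sA; move: A sA j; apply: stem_ind => [j|A x sA xA IHA j].
  by rewrite cardfs0.
by rewrite cardfs_front// addSnnS; exact: leq_trans (npaths_front _ xA) (IHA _).
Qed.

(** * Harmonic functions on stems *)

Section Harmonic.
Context {R : realType}.
Implicit Types f g h : {fset Z} -> R.
Local Open Scope ring_scope.

Definition stem_harmonic h : Prop :=
  (forall A, stem A -> 0 <= h A) /\
  (forall A, stem A -> h A = \sum_(x <- front A) h (x |` A)%fset).

(** Expanding [h A] in [j] steps produces every stem of [up j A] at least once, and dropping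
    repetitions can only decrease the sum. *)
Lemma harmonic_up_le h j A : stem_harmonic h -> stem A ->
  \sum_(B <- up j A) h B <= h A.
Proof.
move=> [h0 hS]; elim: j A => [|j IHj] A sA; first by rewrite big_seq1.
rewrite hS//=; set s := flatten _.
have s0 B : B \in s -> 0 <= h B.
  move=> /flatten_mapP[x xA]; move: (stem_front sA xA) => /mem_up/[apply].
  by case=> sB _ _; exact: h0.
apply: (@le_trans _ _ (\sum_(B <- s) h B)).
  by apply: ler_sum_subset => //; [exact: undup_uniq|move=> B; rewrite mem_undup].
rewrite big_flatten/= big_map big_seq [leRHS]big_seq; apply: ler_sum => x xA.
by apply: IHj; exact: stem_front.
Qed.

(** Each of the at most [k.+1] terms of one expansion is bounded by the whole sum over [up j.+1 A],
    which costs one factor [k.+1] per step. *)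
Lemma le_harmonic_up h j A : stem_harmonic h -> stem A ->
  h A <= k.+1%:R ^+ j * \sum_(B <- up j A) h B.
Proof.
move=> [h0 hS]; elim: j A => [|j IHj] A sA; first by rewrite big_seq1 mul1r.
rewrite hS//; apply: (@le_trans _ _ (\sum_(x <- front A)
    k.+1%:R ^+ j * \sum_(B <- up j.+1 A) h B)).
  rewrite big_seq [leRHS]big_seq; apply: ler_sum => x xA.
  apply: le_trans (IHj _ (stem_front sA xA)) _.
  rewrite ler_wpM2l ?exprn_ge0//; apply: ler_sum_subset.
  - exact: up_uniq.
  - move=> B BxA; rewrite /= mem_undup; apply/flatten_mapP.
    by exists x.
  - by move=> B /(mem_up _ _ sA)[sB _ _]; exact: h0.
rewrite big_const_seq count_predT iter_addr_0 exprS -mulrA -[leLHS]mulr_natl.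
rewrite ler_wpM2r ?ler_nat ?size_front// mulr_ge0 ?exprn_ge0// big_seq sumr_ge0//.
by move=> B /(mem_up _ _ sA)[sB _ _]; exact: h0.
Qed.

Lemma harmonic_npaths h j A m M : stem_harmonic h -> stem A ->
  (forall B, stem B -> #|` B| = (#|` A| + j)%N -> m <= h B <= M) ->
  (npaths j A)%:R * m <= h A <= (npaths j A)%:R * M.
Proof.
move=> [h0 hS]; elim: j A => [|j IHj] A sA mM.
  by rewrite /= !mul1r; apply: mM; rewrite ?addn0.
rewrite hS//= natr_sum !mulr_suml.
have IH x : x \in front A -> (npaths j (x |` A)%fset)%:R * m <=
    h (x |` A)%fset <= (npaths j (x |` A)%fset)%:R * M.
  move=> xA; apply: IHj; first exact: stem_front.
  by move=> B sB cB; apply: mM => //; rewrite cB cardfs_front// addSnnS.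
by apply/andP; split; rewrite big_seq [leRHS]big_seq; apply: ler_sum => x /IH/andP[].
Qed.

(** * Harnack inequality, uniqueness and existence *)

Let K : R := k.+1%:R ^+ k.

(** On stems of the size of [C], a harmonic [h] lies between [S h] and [K * S h]; summing over the
    [E] orderings of that length puts [h fset0] between [E] times these bounds. Combine the upper
    bounds for [g C] and [f fset0] with the lower ones for [f C] and [g fset0]. *)
Lemma harmonic_harnack f g C : stem_harmonic f -> stem_harmonic g -> stem C ->
  g C * f fset0 <= K ^+ 2 * (f C * g fset0).
Proof.
move=> hf hg sC; set E : R := (npaths #|` C| fset0)%:R.
have E0 : 0 < E by rewrite ltr0n npaths_gt0.
have K0 : 0 <= K by rewrite exprn_ge0.
pose S h := \sum_(B <- up k C) h B.
have S0 h : stem_harmonic h -> 0 <= S h.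
  case=> h0 _; rewrite /S big_seq sumr_ge0// => B /(mem_up _ _ sC)[sB _ _].
  exact: h0.
have bnd h B : stem_harmonic h -> stem B -> #|` B| = #|` C| -> S h <= h B <= K * S h.
  (* [perm_up] replaces the extensions of [C] by those of [B], so the same [S h] serves every stem
     of this size. *)
  move=> hh sB cB; rewrite /S (perm_big _ (perm_up sC sB (esym cB))).
  by rewrite harmonic_up_le// le_harmonic_up.
have bnd0 h : stem_harmonic h -> E * S h <= h fset0 <= E * (K * S h).
  move=> hh; apply: (harmonic_npaths hh stem0) => B sB.
  by rewrite cardfs0 add0n => cB; exact: bnd.
have /andP[fC _] := bnd f C hf sC erefl.
have /andP[_ gC] := bnd g C hg sC erefl.
have /andP[_ f0] := bnd0 f hf; have /andP[g0 _] := bnd0 g hg.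
have gC0 := hg.1 _ sC; have f00 := hf.1 _ stem0.
apply: (le_trans (ler_pM gC0 f00 gC f0)).
rewrite [leLHS](_ : _ = K ^+ 2 * (S f * (E * S g))); last by ring.
by rewrite ler_wpM2l ?exprn_ge0// ler_pM ?S0// mulr_ge0 ?S0// ltW.
Qed.

(** Each use of the Harnack inequality improves the factor [1 - c] in front of [g] to
    [1 - (1 - e) * c], and these factors tend to 1. *)
Lemma harmonic_le f g A : stem_harmonic f -> stem_harmonic g ->
  f fset0 = 1 -> g fset0 = 1 -> stem A -> g A <= f A.
Proof.
move=> hf hg f1 g1 sA; set e := (K ^+ 2)^-1.
have K1 : 1 <= K ^+ 2 by rewrite !exprn_ege1// ler1n.
have e01 : 0 < e <= 1 by rewrite invr_gt0 invf_le1 ?K1 ?(lt_le_trans ltr01).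
have H n B : stem B -> (1 - (1 - e) ^+ n) * g B <= f B.
  elim: n B => [|n IHn] B sB; first by rewrite expr0 subrr mul0r; exact: hf.1.
  set c := (1 - e) ^+ n in IHn *.
  (* Harnack applied to [f - (1 - c) g], whose value at the empty stem is [c] *)
  pose h C := f C - (1 - c) * g C.
  have hh : stem_harmonic h.
    split=> C sC; first by rewrite subr_ge0 IHn.
    by rewrite /h hf.2// hg.2// mulr_sumr -sumrB.
  have := harmonic_harnack hh hg sB.
  rewrite {1}/h f1 g1 !mulr1 -ler_pdivrMl ?(lt_le_trans ltr01)// -/e /h exprS -/c.
  by move=> ?; lra.
have cv : (1 - (1 - e) ^+ n) * g A @[n --> \oo] --> (1 - 0) * g A.
  apply: cvgM; last exact: cvg_cst.
  apply: cvgB; first exact: cvg_cst.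
  by apply: cvg_expr; rewrite ger0_norm; lra.
rewrite -[g A]mul1r -[1]subr0; apply: (cvgr_to_le cv).
by near=> n; exact: H.
Unshelve. all: by end_near. Qed.

Lemma harmonic_unique f g A : stem_harmonic f -> stem_harmonic g ->
  f fset0 = 1 -> g fset0 = 1 -> stem A -> f A = g A.
Proof. by move=> *; apply/eqP; rewrite eq_le !harmonic_le. Qed.

Lemma harmonic_exists : exists2 f, stem_harmonic f & f fset0 = 1.
Proof.
have [U [UU oU]] := ultraFilterLemma (@eventually_filter).
(* The probability that a uniform ordering of length [n] begins with a given ordering of [A]. The
   truncated subtraction makes it meaningless when [A] has more than [n] elements, but [U] only sees
   large [n]. *)
pose r n A : R := (npaths (n - #|` A|) A)%:R / (npaths n fset0)%:R.
have U_ge N : U [set n | (N <= n)%N] by apply: oU; exists N.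
have r01 n A : stem A -> (#|` A| <= n)%N -> r n A \in `[0, 1].
  move=> sA An; rewrite in_itv/= divr_ge0//= ler_pdivrMr ?ltr0n ?npaths_gt0//.
  by rewrite mul1r ler_nat; have := npaths_le (n - #|` A|) sA; rewrite subnKC.
have rS n A : stem A -> (#|` A| < n)%N ->
    r n A = \sum_(x <- front A) r n (x |` A)%fset.
  move=> sA An; rewrite /r -mulr_suml; congr (_ / _).
  rewrite -subnSK//= natr_sum.
  by rewrite big_seq [RHS]big_seq; apply: eq_bigr => x xA; rewrite cardfs_front.
have cvgr A : exists p : R, stem A -> r n A @[n --> U] --> p.
  have [sA|] := pselect (stem A); last by exists 0.
  have [|p _ rp] := @ultra_compact_cvg _ _ U (r^~ A) _ UU (@segment_compact R 0 1).
    by apply: filterS (U_ge #|` A|) => n; exact: r01.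
  by exists p.
have [f fP] := choice cvgr.
exists f; first split=> A sA.
- apply: (cvgr_to_ge (fP A sA)); apply: filterS (U_ge #|` A|) => n An.
  by have := r01 n A sA An; rewrite in_itv/= => /andP[].
- have fS : r n A @[n --> U] --> \sum_(x <- front A) f (x |` A)%fset.
    (* Keeping membership in the front as a condition on the index records that each extension is a
       stem, as [fP] requires. *)
    rewrite big_seq; have cv : \sum_(x <- front A | x \in front A)
        r n (x |` A)%fset @[n --> U] -->
        \sum_(x <- front A | x \in front A) f (x |` A)%fset.
      apply: (@cvg_big R Z +%R) => [|x xA]; first exact: (@add_continuous R).
      by apply: fP; exact: stem_front.
    apply: cvg_trans cv; apply: near_eq_cvg.
    by apply: filterS (U_ge #|` A|.+1) => n An; rewrite rS// big_seq.
  exact: (cvg_unique _ (fP A sA) fS).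
- have f1 : r n fset0 @[n --> U] --> (1 : R).
    apply: cvg_near_cst; apply: filterS (U_ge 0) => n _.
    by rewrite /r cardfs0 subn0 divff// pnatr_eq0 -lt0n npaths_gt0.
  exact: (cvg_unique _ (fP _ stem0) f1).
Qed.

End Harmonic.

(** * Strings and basic events *)

(* Histories list the letters of a string most recent first. *)
Fixpoint history (s : seq Z) : bool :=
  if s is x :: s' then (x \in front [fset y in s']%fset) && history s' else true.

Lemma history_uniq s : history s -> uniq s.
Proof.
elim: s => //= x s IHs /andP[/front_notin xs /IHs ->].
by move: xs; rewrite inE andbT.
Qed.

Lemma history_stem s : history s -> stem [fset y in s]%fset.
Proof.
elim: s => [_|x s IHs /= /andP[xs /IHs]]; first by rewrite fset_nil; exact: stem0.
by rewrite fset_cons => /stem_front; exact.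
Qed.

Lemma stem_history A : stem A -> exists2 s, history s & [fset y in s]%fset = A.
Proof.
move: A; apply: stem_ind => [|A x _ xA [s hs sA]].
  by exists [::]; rewrite ?fset_nil.
by exists (x :: s); rewrite ?fset_cons ?sA//= sA xA.
Qed.

(** The conditions of an ordered stem read backwards: with recent letters first, no letter lies
    below one that follows it in the list. *)
Lemma historyP s : history s <-> [/\ uniq s, down_set [set` s] &
  pairwise (fun x y => ~~ (x < y)%O) s].
Proof.
elim: s => [|x s [IH1 IH2]] /=; first by split=> // _; split.
split=> [/andP[/mem_front[/= xs minx] /IH1[us ds ->]]|].
  rewrite inE in xs; rewrite us (introN idP xs) !andbT; split=> //.
    move=> y z /=; rewrite !inE => /orP[/eqP->|/ds zs] yz; last first.
      by rewrite (zs _ yz) orbT.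
    move: yz; rewrite le_eqVlt => /orP[->//|yx]; apply/orP; right.
    apply: contraPT yx => ys; apply/negP/minx => /=.
    by rewrite inE; exact/negP.
  by apply/allP => y ys; apply: contra_notN xs => /ltW/(ds _ _ ys).
move=> [/andP[xs us] ds /andP[/allP xmin pw]]; apply/andP; split.
  apply/mem_front; split; first by rewrite /= inE; exact/negP.
  move=> y /=; rewrite inE => /negP ys; apply/negP => yx.
  have := ds y x; rewrite /= !inE eqxx (negPf ys) orbF => /(_ isT (ltW yx))/eqP yx'.
  by rewrite yx' ltxx in yx.
apply: IH2; split=> // y z /= zs yz.
have := ds y z; rewrite /= !inE zs orbT => /(_ isT yz)/orP[/eqP yx|//].
move: yz; rewrite yx le_eqVlt => /orP[/eqP xz|xz]; first by rewrite xz zs in xs.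
by have /negP := xmin _ zs.
Qed.

Lemma ordered_stemP n (a : n.-tuple Z) : ordered_stem a <-> history (rev a).
Proof.
rewrite historyP rev_uniq.
have revE : down_set [set` rev a] = down_set [set` a].
  by congr down_set; apply/seteqP; split=> x /=; rewrite mem_rev.
have [x0 _] := front_neq0 fset0.
suff pwE : (forall i j : 'I_n, (tnth a i < tnth a j)%O -> (i < j)%N) <->
    pairwise (fun x y => ~~ (x < y)%O) (rev a).
  by split; rewrite revE => -[? ? ?]; split => //; exact/pwE.
(* Reversal sends position [i] of a string of length [m] to [m - i.+1]. *)
have revlt i m : (i < m)%N -> (m - i.+1 < m)%N.
  by case: m => // m _; rewrite subSS ltnS leq_subr.
split=> [lta|/(pairwiseP x0) pw i j].
  apply/(pairwiseP x0) => i j; rewrite !inE size_rev size_tuple => iln jln ij.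
  rewrite !nth_rev ?size_tuple//; apply/negP => aij.
  have := lta (Ordinal (revlt _ _ iln)) (Ordinal (revlt _ _ jln)).
  by rewrite !(tnth_nth x0)/= => /(_ aij); rewrite ltnNge (leq_sub2l _ (leqW ij)).
rewrite !(tnth_nth x0) => aij; rewrite ltnNge; apply/negP.
rewrite leq_eqVlt => /orP[/eqP ji|ji]; first by rewrite ji ltxx in aij.
have := pw (n - i.+1)%N (n - j.+1)%N; rewrite !inE size_rev size_tuple.
rewrite !revlt// ltn_sub2l ?(leq_ltn_trans ji)// => /(_ isT isT isT).
by rewrite !nth_rev ?size_tuple ?revlt// !subnSK// !subKn ?aij// ltnW.
Qed.

Notation event s := (basic_event (rev s) : set (OmegaT Z)).

(** The condition defining [Omega] says that each letter lies in the front of the set of its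
    predecessors. *)
Lemma mkseq_history (w : OmegaT Z) n : history (rev (mkseq (\val w) n)).
Proof.
have /set_mem wO := valP w; elim: n => // n IHn.
rewrite mkseqS rev_rcons /= IHn andbT; apply/mem_front.
suff -> : ~` [set` [fset y in rev (mkseq (\val w) n)]%fset] = ~` (\val w @` `I_n).
  exact: wO.
congr (~` _); apply/seteqP; split=> x /=; rewrite inE mem_rev.
  by move=> /mapP[i]; rewrite mem_iota => iln ->; exists i.
by move=> [i iln <-]; apply/mapP; exists i; rewrite ?mem_iota.
Qed.

Lemma event_history s (w : OmegaT Z) : event s w -> history s.
Proof. by rewrite -[in history s](revK s) => <-; exact: mkseq_history. Qed.

Lemma event_nil : event [::] = setT.
Proof. by apply/seteqP; split. Qed.

Lemma event_cons x s : event (x :: s) = event s `&` [set w | \val w (size s) = x].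
Proof.
apply/seteqP; split=> w; rewrite /basic_event /= rev_cons size_rcons size_rev.
  by rewrite mkseqS => /rcons_inj[-> ->].
by move=> [ws wx]; rewrite mkseqS ws wx.
Qed.

Lemma event_front s :
  event s = \big[setU/set0]_(x <- front [fset y in s]%fset) event (x :: s).
Proof.
apply/seteqP; split=> w; rewrite -bigcup_seq.
  move=> ws; have wxs : event (\val w (size s) :: s) w by rewrite event_cons.
  by exists (\val w (size s)) => //=; have /= /andP[] := event_history wxs.
by move=> [x _]; rewrite event_cons => -[].
Qed.

(** Two basic events are nested or disjoint, according to whether the shorter string is a prefix of
    the longer. *)
Lemma setI_closed_basic_event : setI_closed (range (@basic_event d Z)).
Proof.
move=> _ _ [a _ <-] [b _ <-].
wlog ab : a b / (size a <= size b)%N.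
  move=> H; have /orP[|] := leq_total (size a) (size b); first exact: H.
  by rewrite setIC; exact: H.
have [E|NE] := eqVneq (take (size a) b) a.
  exists b => //; apply/esym/setIidPr => w wb; rewrite /basic_event /=.
  by rewrite -[RHS]E -wb /mkseq -map_take take_iota (minn_idPl ab).
(* The empty set has to be a basic event as well: a string with a repeated letter provides it. *)
have [x0 _] := front_neq0 fset0.
exists [:: x0; x0] => //; rewrite (_ : basic_event _ `&` _ = set0).
  rewrite -subset0 => w /(@event_history [:: x0; x0])/history_uniq.
  by rewrite /= inE eqxx.
rewrite -subset0 => w [wa wb]; move/negP: NE; apply; apply/eqP.
by rewrite -wa -[in LHS]wb size_mkseq /mkseq -map_take take_iota (minn_idPl ab).
Qed.

(** * Order-invariant measures *)

Section Measures.
Context {R : realType}.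
Implicit Types nu mu : probability (Fsigma Z) R.
Local Open Scope ring_scope.

Lemma measurable_event s : measurable (event s : set (Fsigma Z)).
Proof. by apply: sub_sigma_algebra; exists (rev s). Qed.

(** Additivity over the possible next letters; for an order-invariant measure this becomes the
    harmonic equation. *)
Lemma measure_event_front nu s :
  nu (event s) = (\sum_(x <- front [fset y in s]%fset) nu (event (x :: s)))%E.
Proof.
rewrite [in LHS]event_front measure_fbigsetU//.
  by move=> x _; exact: measurable_event.
apply/trivIsetP => x y _ _ xy; rewrite -subset0 => w; rewrite !event_cons.
by move=> [[_ /= wx] [_ /= wy]]; move/eqP: xy; apply; rewrite -wx.
Qed.

Lemma order_invariant_event nu s t : order_invariant nu -> history s ->
  history t -> [fset y in s]%fset = [fset y in t]%fset ->
  nu (event s) = nu (event t).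
Proof.
move=> inv hs ht st; have : perm_eq (rev t) (in_tuple (rev s)).
  rewrite /= perm_rev perm_sym perm_rev perm_sym.
  apply: uniq_perm; rewrite ?history_uniq// => y.
  by have := congr1 (fun A : {fset Z} => y \in A) st; rewrite !inE.
move=> /tuple_permP[p tE].
rewrite tE; apply: (inv _ (in_tuple (rev s))); apply/ordered_stemP.
  by rewrite revK.
by rewrite -tE revK.
Qed.

Lemma order_invariant_harmonic nu : order_invariant nu ->
  exists h : {fset Z} -> R, [/\ stem_harmonic h, h fset0 = 1 &
    forall s, history s -> nu (event s) = (h [fset y in s]%fset)%:E].
Proof.
move=> inv.
(* An ordering is chosen for each stem; other sets get the empty list, so that the choice is
   total. *)
have sE A : exists s, stem A -> history s /\ [fset y in s]%fset = A.
  have [/stem_history[s hs sA]|//] := pselect (stem A); first by exists s.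
  by exists [::].
have [s sP] := choice sE.
pose h A : R := fine (nu (event (s A))).
have hE t : history t -> nu (event t) = (h [fset y in t]%fset)%:E.
  move=> ht; have [hs st] := sP _ (history_stem ht).
  rewrite (order_invariant_event inv ht hs (esym st)) fineK//.
  by rewrite fin_num_measure//; exact: measurable_event.
exists h; split=> //.
  split=> A sA; first by rewrite fine_ge0.
  have [hs sA'] := sP _ sA; apply: EFin_inj.
  rewrite -[in LHS]sA' -hE// measure_event_front sA' -sumEFin.
  rewrite big_seq [RHS]big_seq; apply: eq_bigr => x xA.
  by rewrite hE ?fset_cons ?sA'//= sA' xA.
have := hE [::] isT; rewrite fset_nil event_nil probability_setT.
by move=> [<-].
Qed.

Lemma order_invariant_unique nu mu : order_invariant nu -> order_invariant mu ->
  forall E : set (Fsigma Z), measurable E -> nu E = mu E.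
Proof.
move=> inu imu E mE.
(* Basic events form a generating pi-system that contains the whole space, as the event of the empty
   string, so agreement on them suffices. *)
apply: (@measure_unique _ R (Fsigma Z) (range (@basic_event d Z)) (fun=> setT)
  erefl _ _ _ nu mu) => //.
- exact: setI_closed_basic_event.
- by move=> _; exists [::] => //; exact: event_nil.
- by rewrite bigcup_const.
- move=> _ [a _ <-]; rewrite -[a]revK.
  have [ha|/negP Nha] := boolP (history (rev a)); last first.
    rewrite (_ : basic_event _ = set0) ?measure0//.
    by rewrite -subset0 => w /event_history.
  have [h [hh h1 hE]] := order_invariant_harmonic inu.
  have [g [hg g1 gE]] := order_invariant_harmonic imu.
  transitivity (h [fset y in rev a]%fset)%:E; first exact: hE ha.
  rewrite (harmonic_unique hh hg h1 g1 (history_stem ha)).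
  exact/esym/(gE _ ha).
- by move=> _; rewrite /= (probability_setT nu) ltry.
Qed.

(** * Construction of a measure from a harmonic function *)

Section IntervalSplitting.
Variable f : {fset Z} -> R.
Hypotheses (f_harm : stem_harmonic f) (f1 : f fset0 = 1).

Let g (s : seq Z) x := f (x |` [fset y in s])%fset.

Fixpoint left_end (s : seq Z) : R :=
  if s is x :: s' then
    left_end s' + offset (g s') (front [fset y in s']%fset) x
  else 0.

(** Half-open, so that the cells of the one-letter extensions of [s] partition that of [s]: see
    [cell_cons_sub], [cell_cons_inj] and [cell_cons_exists]. *)
Definition cell (s : seq Z) : interval R :=
  `[left_end s, (left_end s + f [fset y in s]%fset)[.

Let g_ge0 s : history s ->
  forall x, x \in front [fset y in s]%fset -> 0 <= g s x.
Proof. by move=> hs x xs; apply: f_harm.1; apply/stem_front/xs/history_stem. Qed.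

Let f_sum s : history s ->
  f [fset y in s]%fset = \sum_(x <- front [fset y in s]%fset) g s x.
Proof. by move=> hs; rewrite f_harm.2//; exact: history_stem. Qed.

Lemma cell_cons_sub x s t : history (x :: s) -> t \in cell (x :: s) ->
  t \in cell s.
Proof.
move=> /=/andP[xs hs]; rewrite !in_itv/= fset_cons => /andP[lt tl].
have o0 := offset_ge0 (g_ge0 hs) x; have oS := offset_sum (g_ge0 hs) xs.
rewrite -f_sum// in oS; apply/andP; split.
  by apply: le_trans lt; rewrite lerDl.
by apply: (lt_le_trans tl); rewrite -addrA lerD2l.
Qed.

Lemma cell_cons_inj x y s t : history (x :: s) -> history (y :: s) ->
  t \in cell (x :: s) -> t \in cell (y :: s) -> x = y.
Proof.
wlog xy : x y / (index x (front [fset z in s]%fset) <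
                 index y (front [fset z in s]%fset))%N.
  move=> H hx hy tx ty; have /= /andP[xs _] := hx; have /= /andP[ys _] := hy.
  have [xy|yx|] := ltngtP (index x (front [fset z in s]%fset))
    (index y (front [fset z in s]%fset)); [exact: H|by apply/esym; exact: H|].
  by move=> /(congr1 (nth x (front [fset z in s]%fset))); rewrite !nth_index.
move=> /=/andP[xs hs] _; rewrite !in_itv/= !fset_cons => /andP[_ tx] /andP[ty _].
have := offset_index (g_ge0 hs) xs xy; rewrite -(lerD2l (left_end s)) addrA.
by move=> /(lt_le_trans tx)/lt_le_trans/(_ ty); rewrite ltxx.
Qed.

Lemma cell_cons_exists s t : history s -> t \in cell s ->
  exists2 x, x \in front [fset y in s]%fset & t \in cell (x :: s).
Proof.
move=> hs; rewrite in_itv/= => /andP[lt tl].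
have [||x xs xt] := @offset_inv _ _ (g s) (front [fset y in s]%fset)
  (t - left_end s); first exact: front_uniq.
  by rewrite -f_sum// subr_ge0 lt ltrBlDl.
exists x => //; rewrite in_itv/= fset_cons -/(g s x).
by rewrite -addrA -lerBrDl -ltrBlDl.
Qed.

(* The fallback outside [cell s] does not depend on [t], which makes the paths
   measurable on the whole line. *)
Definition next t (s : seq Z) : Z :=
  if pselect (exists x, (x \in front [fset y in s]%fset) && (t \in cell (x :: s)))
  is left ex then xchoose ex else xchoose (front_neq0 [fset y in s]%fset).

Lemma next_front t s : next t s \in front [fset y in s]%fset.
Proof.
rewrite /next; case: pselect => [ex|_]; last exact: xchooseP.
by have /andP[] := xchooseP ex.
Qed.

Lemma next_cell t s : history s -> t \in cell s -> t \in cell (next t s :: s).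
Proof.
move=> hs /(cell_cons_exists hs)[x xs xt]; rewrite /next.
case: pselect => [ex|[]]; first by have /andP[] := xchooseP ex.
by exists x; rewrite xs.
Qed.

Lemma next_notin t s : history s -> t \notin cell s ->
  next t s = xchoose (front_neq0 [fset y in s]%fset).
Proof.
move=> hs /negP ts; rewrite /next; case: pselect => // ex.
by have [x /andP[xs xt]] := ex; case: ts; apply: cell_cons_sub xt; rewrite /= xs.
Qed.

Definition prefix t n : seq Z := iter n (fun s => next t s :: s) [::].

Lemma history_prefix t n : history (prefix t n).
Proof. by elim: n => //= n ->; rewrite next_front. Qed.

Lemma size_prefix t n : size (prefix t n) = n.
Proof. by elim: n => //= n ->. Qed.

Lemma mkseq_prefix t n : rev (mkseq (fun n => next t (prefix t n)) n) = prefix t n.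
Proof. by elim: n => // n IHn; rewrite mkseqS rev_rcons IHn. Qed.

Lemma prefix_Omega t : (fun n => next t (prefix t n)) \in Omega Z.
Proof.
apply/mem_set => n; move: ((mem_front _ _).1 (next_front t (prefix t n))).
congr (minimal_in (~` _) _); apply/seteqP; split=> x /=; rewrite inE -mkseq_prefix mem_rev.
  by move=> /mapP[i]; rewrite mem_iota => iln ->; exists i.
by move=> [i iln <-]; apply/mapP; exists i; rewrite ?mem_iota.
Qed.

Definition path_of t : Fsigma Z := exist (fun w => w \in Omega Z) _ (prefix_Omega t).

Lemma path_of_event t s : event s (path_of t) <-> prefix t (size s) = s.
Proof.
rewrite -(mkseq_prefix t (size s)) /basic_event /= size_rev.
by split=> [->|sE]; rewrite ?revK// -[in RHS]sE revK.
Qed.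

(** The induction starts because the cell of the empty history is [0, 1[, by [f1]; each further
    letter selects the unique subcell containing [t]. *)
Lemma prefix_cell t s : 0 <= t < 1 -> history s ->
  prefix t (size s) = s <-> t \in cell s.
Proof.
move=> t01; elim: s => [_|x s IHs hxs].
  by split=> // _; rewrite in_itv/= add0r fset_nil f1.
have /= /andP[xs hs] := hxs; have [IH1 IH2] := IHs hs; split.
  by move=> [nx ps]; rewrite -[x]nx ps next_cell// IH1.
move=> tx; have ts := cell_cons_sub hxs tx; rewrite (IH2 ts); congr (_ :: _).
by apply: cell_cons_inj tx; rewrite ?next_cell//= next_front.
Qed.

Lemma measurable_prefix s : history s ->
  measurable [set t : R | prefix t (size s) = s].
Proof.
elim: s => [_|x s IHs hxs].
  by rewrite (_ : [set _ | _] = setT)//; apply/seteqP; split.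
have mcst (Q : Prop) : measurable [set u : R | Q].
  by have [q|q] := pselect Q; [rewrite (_ : mkset _ = setT)|
    rewrite (_ : mkset _ = set0)] => //; apply/seteqP; split.
have /= /andP[xs hs] := hxs.
pose D := [set t : R | prefix t (size s) = s].
(* Once the earlier letters are [s], the next one is [x] either because [t] is in the subcell of
   [x], or because [t] is outside [cell s] and the fallback letter is [x]. *)
pose C := [set` cell (x :: s)] `|` (~` [set` cell s] `&`
  [set u | xchoose (front_neq0 [fset y in s]%fset) = x]).
rewrite (_ : [set _ | _] = D `&` C).
  apply: measurableI; first exact: IHs.
  apply: measurableU; first exact: measurable_itv.
  by apply: measurableI; [apply: measurableC; exact: measurable_itv|exact: mcst].
apply/seteqP; split=> t /=.
  move=> [nx ps]; split=> //; rewrite ps in nx.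
  have [ts|ts] := boolP (t \in cell s); first by left; have := next_cell hs ts; rewrite nx.
  by right; split; [exact/negP|rewrite /= -(next_notin hs ts)].
move=> [ps [tx|[/negP ts xE]]]; rewrite ps; congr (_ :: _).
  have ts := cell_cons_sub hxs tx.
  by apply: cell_cons_inj tx; rewrite ?next_cell//= next_front.
by rewrite next_notin.
Qed.

Lemma measurable_path_of : measurable_fun [set: R] path_of.
Proof.
apply: (@measurability _ _ R (Fsigma Z) setT path_of (range (@basic_event d Z))
  erefl) => _ [_ [a _ <-] <-].
rewrite setTI -[a]revK.
have [ha|/negP Nha] := boolP (history (rev a)).
  rewrite (_ : _ @^-1` _ = [set t | prefix t (size (rev a)) = rev a]).
    exact: measurable_prefix.
  by apply/seteqP; split=> t /= /path_of_event.
rewrite (_ : _ @^-1` _ = set0)// -subset0 => t /=.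
by move=> /event_history.
Qed.

Lemma lebesgue_prefix s : history s ->
  lebesgue_measure ([set t : R | prefix t (size s) = s] `&` `[0, 1[) =
  (f [fset y in s]%fset)%:E.
Proof.
move=> hs; have cell01 t : t \in cell s -> 0 <= t < 1.
  elim: s hs => [_|x s IHs /[dup] hxs /=/andP[_ hs]].
    by rewrite in_itv/= add0r fset_nil f1.
  by move=> /(cell_cons_sub hxs); exact: IHs.
rewrite (_ : _ `&` _ = [set` cell s]).
  rewrite lebesgue_measure_itv/= lte_fin ltrDl.
  (* A stem of value 0 has an empty cell, a separate case of the length formula. *)
  have := f_harm.1 _ (history_stem hs); rewrite le_eqVlt => /orP[/eqP<-|->].
    by rewrite ltxx.
  by rewrite -EFinB addrC addKr.
apply/seteqP; split=> t /=; rewrite in_itv/=.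
  by move=> [ps t01]; exact/prefix_cell.
by move=> tc; have t01 := cell01 t tc; split=> //; exact/prefix_cell.
Qed.

Lemma harmonic_order_invariant : exists mu, order_invariant mu.
Proof.
pose lam : {measure set (measurableTypeR R) -> \bar R} :=
  mrestr (@lebesgue_measure R) (measurable_itv `[0, 1[).
(* As [lam] has mass 1, normalising keeps its values and supplies the structure of a probability. *)
pose P := mnormalize lam point.
pose pathT : measurableTypeR R -> Fsigma Z := path_of.
pose X : {mfun measurableTypeR R >-> Fsigma Z} := HB.pack pathT
  (isMeasurableFun.Build _ _ (measurableTypeR R) (Fsigma Z) pathT measurable_path_of).
have lam1 : lam setT = 1%E.
  by rewrite /lam/= /mrestr setTI lebesgue_measure_itv/= lte_fin ltr01 oppr0 adde0.
have muE s : history s ->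
    distribution P X (event s) = (f [fset y in s]%fset)%:E.
  move=> hs; rewrite /distribution /pushforward /= /mnormalize lam1.
  rewrite onee_eq0/= invr1 mule1 -lebesgue_prefix// /mrestr.
  congr (lebesgue_measure (_ `&` _)).
  by apply/seteqP; split=> t /= /path_of_event.
exists (distribution P X) => n a s oa oas.
have := muE _ ((ordered_stemP _).1 oa); have := muE _ ((ordered_stemP _).1 oas).
rewrite !revK => muas mua; apply: (eq_trans mua); apply/esym/(eq_trans muas).
(* Order invariance: [f] depends only on the set of letters, which a permutation preserves. *)
congr (f _)%:E; apply/fsetP => x; rewrite !inE !mem_rev; apply: perm_mem.
by apply/tuple_permP; exists s.
Qed.

End IntervalSplitting.
End Measures.
End Stems.

(* Measures are functions on all subsets, unspecified off the sigma-algebra: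
   equality of measures is equality on measurable sets. *)
Theorem theorem8p1 (R : realType) (d : Order.disp_t) (Z : causalSetType d)
    (hI : exists k : nat, forall x : Z, incomparables x #<= `I_k) :
  exists mu : probability (Fsigma Z) R,
    order_invariant mu /\
    forall nu : probability (Fsigma Z) R, order_invariant nu ->
      forall A : set (Fsigma Z), measurable A -> nu A = mu A.
Proof.
have [k incomparables_le] := hI.
have [f hf f1] := @harmonic_exists d Z k incomparables_le R.
have [mu imu] := harmonic_order_invariant incomparables_le hf f1.
exists mu; split=> // nu inu.
exact: (order_invariant_unique incomparables_le inu imu).
Qed.
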